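(* Let $\mathcal{G}=(\mathcal{V},\mathcal{E})$ be a temporal graph with lifetime $\mathcal{T}$ and $m=|\mathcal{E}|$ edges (edges possibly associated with multiple time intervals), and let $\Delta$ be the maximum degree of a node in the underlying graph of $\mathcal{G}$. Then the greedy algorithm described in the context outputs a maximal 0-1 timed matching for $\mathcal{G}$, and it runs in $O(m^2+m\Delta^2+m\Delta\mathcal{T}\log\mathcal{T})$ time.
   Context: A temporal graph $\mathcal{G}=(\mathcal{V},\mathcal{E})$ with lifetime $\mathcal{T}$ has a finite node set and a finite edge set; each edge joins two distinct nodes (no self-loops, at most one edge per pair) and is associated with a nonempty list of time intervals $[s_1,f_1),\dots,[s_k,f_k)$ with integers $0\le s_1<f_1<s_2<\dots<s_k<f_k\le\mathcal{T}$, existing at each integer timestep in one of them. The underlying graph is the static graph on $\mathcal{V}$ with an edge $\{u,v\}$ per temporal edge between $u,v$. Two distinct edges overlap if they share an endpoint and exist at a common timestep. A 0-1 timed matching is a set of edges no two of which overlap; it is maximal if no edge of $\mathcal{E}$ outside it can be added keeping it a 0-1 timed matching. Greedy algorithm: let $E':=\mathcal{E}$, $M:=\emptyset$; for each edge compute its overlapping number (number of edges of $E'$ overlapping it) and its set of overlapping edges. While $E'\ne\emptyset$: choose $e\in E'$ with minimum overlapping number with respect to $E'$ (ties broken arbitrarily), add $e$ to $M$, remove $e$ and all edges of $E'$ overlapping $e$ from $E'$, and update the overlapping numbers and overlapping-edge sets of the remaining edges. Output $M$. *)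

(* Defs.v *)
From mathcomp Require Import all_boot.

Set Implicit Arguments.
Unset Strict Implicit.
Unset Printing Implicit Defensive.

(** * Temporal graphs *)

(* [ivals e] lists the pairs (s_j, f_j) encoding the half-open intervals
   [s_j, f_j); [ivals_sorted] is s_1 < f_1 < s_2 < f_2 < ... *)
Record temporal_graph (V E : finType) (T : nat) := TemporalGraph {
  ends : E -> {set V};
  ivals : E -> seq (nat * nat);
  ends_card : forall e, #|ends e| = 2;
  ends_inj : injective ends;
  ivals_neq0 : forall e, ivals e != [::];
  ivals_sorted : forall e,
    sorted ltn (flatten [seq [:: i.1; i.2] | i <- ivals e]);
  ivals_lifetime : forall e i, i \in ivals e -> i.2 <= T }.

Section TemporalGraphTheory.
Variables (V E : finType) (T : nat) (G : temporal_graph V E T).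
Implicit Types (e f : E) (u v : V) (M : {set E}).

Definition exists_at e (t : nat) : bool :=
  has (fun i => i.1 <= t < i.2) (ivals G e).

Definition underlying_adj : rel V :=
  [rel u v | [exists e, ends G e == [set u; v]]].

Definition degree u : nat := #|[set v | underlying_adj u v]|.

Definition max_degree : nat := \max_(u : V) degree u.

(* No edge exists outside the timesteps 0, ..., T - 1. *)
Definition overlap e f : bool :=
  [&& e != f, ends G e :&: ends G f != set0
    & [exists t : 'I_T, exists_at e t && exists_at f t]].

Definition timed_matching M : bool :=
  [forall e in M, forall f in M, ~~ overlap e f].

Definition maximal_timed_matching M : Prop :=
  timed_matching M /\ forall e, e \notin M -> ~~ timed_matching (e |: M).

(** * The greedy algorithm, with arbitrary tie-breaking *)

Definition overlapping_edges (E' : {set E}) e : {set E} := [set f in E' | overlap e f].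

Definition overlapping_number (E' : {set E}) e : nat := #|overlapping_edges E' e|.

(* [greedy_from E' M M'] : the loop started with the values E' and M of its
   two variables may end with M' as the value of M. *)
Inductive greedy_from : {set E} -> {set E} -> {set E} -> Prop :=
| greedy_stop M : greedy_from set0 M M
| greedy_step (E' M M' : {set E}) e :
    e \in E' ->
    (forall f, f \in E' -> overlapping_number E' e <= overlapping_number E' f) ->
    greedy_from (E' :\: (e |: overlapping_edges E' e)) (e |: M) M' ->
    greedy_from E' M M'.

Definition greedy_output M : Prop := greedy_from [set: E] set0 M.

(* [trunc_log 2 T] is the floor of the binary logarithm of T. *)
Definition time_bound : nat :=
  #|E| ^ 2 + #|E| * max_degree ^ 2 + #|E| * max_degree * T * trunc_log 2 T.

End TemporalGraphTheory.

(** * A unit-cost random access machine *)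

Inductive register :=
  Rm | Ri | Rj | Ro | Ra | Raend | Rb | Rbend | Rp | Re | Rc | Rr | Rx | Rq
| Ry | Rz | Rk.

Inductive array :=
  Aeu | Aev | Ais | Aif | Aib | Ail | Aalive | Abase | Anum | Aadj | Aout.

Scheme Boolean Equality for register.
Scheme Boolean Equality for array.

(* The store has registers, arrays, and a stream of bits that resolve the
   nondeterministic command [Flip]. *)
Record store := Store {
  reg : register -> nat;
  mem : array -> nat -> nat;
  coins : nat -> bool }.

Definition set_reg (s : store) (x : register) (v : nat) : store :=
  Store (fun y => if register_beq y x then v else reg s y) (mem s) (coins s).

Definition set_mem (s : store) (a : array) (k v : nat) : store :=
  Store (reg s)
    (fun b l => if array_beq b a && (l == k) then v else mem s b l) (coins s).

Inductive aexp :=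
| Const of nat
| Var of register
| Get of array & aexp
| Add of aexp & aexp
| Sub of aexp & aexp.

Inductive bexp :=
| Lt of aexp & aexp
| Le of aexp & aexp
| Eq of aexp & aexp
| Not of bexp
| And of bexp & bexp
| Or of bexp & bexp.

Inductive cmd :=
| Assign of register & aexp
| Put of array & aexp & aexp
| Flip of register
| Seq of cmd & cmd
| If of bexp & cmd & cmd
| Skip
| While of bexp & cmd.

Fixpoint aval (s : store) (e : aexp) : nat :=
  match e with
  | Const n => n
  | Var x => reg s x
  | Get a e1 => mem s a (aval s e1)
  | Add e1 e2 => aval s e1 + aval s e2
  | Sub e1 e2 => aval s e1 - aval s e2
  end.

Fixpoint bval (s : store) (b : bexp) : bool :=
  match b with
  | Lt e1 e2 => aval s e1 < aval s e2
  | Le e1 e2 => aval s e1 <= aval s e2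
  | Eq e1 e2 => aval s e1 == aval s e2
  | Not b1 => ~~ bval s b1
  | And b1 b2 => bval s b1 && bval s b2
  | Or b1 b2 => bval s b1 || bval s b2
  end.

(* Every constant, register access, array access, arithmetic operation,
   comparison and connective takes one time unit. *)
Fixpoint acost (e : aexp) : nat :=
  match e with
  | Const _ | Var _ => 1
  | Get _ e1 => (acost e1).+1
  | Add e1 e2 | Sub e1 e2 => (acost e1 + acost e2).+1
  end.

Fixpoint bcost (b : bexp) : nat :=
  match b with
  | Lt e1 e2 | Le e1 e2 | Eq e1 e2 => (acost e1 + acost e2).+1
  | Not b1 => (bcost b1).+1
  | And b1 b2 | Or b1 b2 => (bcost b1 + bcost b2).+1
  end.

(* [exec c s t s'] : started in s, the command c terminates in s' after
   exactly t time units. For a given stream of coins, c has at most one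
   execution from s. *)
Inductive exec : cmd -> store -> nat -> store -> Prop :=
| exec_assign x e s :
    exec (Assign x e) s (acost e).+1 (set_reg s x (aval s e))
| exec_put a e1 e2 s :
    exec (Put a e1 e2) s (acost e1 + acost e2).+1
      (set_mem s a (aval s e1) (aval s e2))
| exec_flip x s :
    exec (Flip x) s 1
      (set_reg (Store (reg s) (mem s) (fun n => coins s n.+1)) x (coins s 0))
| exec_seq c1 c2 s s1 s2 t1 t2 :
    exec c1 s t1 s1 -> exec c2 s1 t2 s2 -> exec (Seq c1 c2) s (t1 + t2) s2
| exec_if_true b c1 c2 s s' t :
    bval s b -> exec c1 s t s' -> exec (If b c1 c2) s (bcost b + t).+1 s'
| exec_if_false b c1 c2 s s' t :
    ~~ bval s b -> exec c2 s t s' -> exec (If b c1 c2) s (bcost b + t).+1 s'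
| exec_skip s : exec Skip s 1 s
| exec_while_stop b c s :
    ~~ bval s b -> exec (While b c) s (bcost b).+1 s
| exec_while_loop b c s s1 s2 t1 t2 :
    bval s b -> exec c s t1 s1 -> exec (While b c) s1 t2 s2 ->
    exec (While b c) s (bcost b + t1 + t2).+1 s2.

Coercion Const : nat >-> aexp.
Coercion Var : register >-> aexp.

Declare Scope ram_scope.
Delimit Scope ram_scope with ram.
Bind Scope ram_scope with aexp.
Bind Scope ram_scope with bexp.
Bind Scope ram_scope with cmd.
Notation "a .[ e ]" := (Get a e) : ram_scope.
Notation "e1 + e2" := (Add e1 e2) : ram_scope.
Notation "e1 - e2" := (Sub e1 e2) : ram_scope.
Notation "e1 < e2" := (Lt e1 e2) : ram_scope.
Notation "e1 <= e2" := (Le e1 e2) : ram_scope.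
Notation "e1 == e2" := (Eq e1 e2) : ram_scope.
Notation "e1 != e2" := (Not (Eq e1 e2)) : ram_scope.
Notation "b1 && b2" := (And b1 b2) : ram_scope.
Notation "b1 || b2" := (Or b1 b2) : ram_scope.
Notation "x ::= e" := (Assign x e) (at level 72) : ram_scope.
Notation "a .[ e1 ] ::= e2" := (Put a e1 e2)
  (at level 1, left associativity, e2 at level 71,
   format "a .[ e1 ]  ::=  e2") : ram_scope.
Notation "c1 ;; c2" := (Seq c1 c2)
  (at level 90, right associativity, format "'[v' c1 ;; '/' c2 ']'") : ram_scope.
Notation "'IF' b 'THEN' c1 'ELSE' c2 'FI'" := (If b c1 c2)
  (at level 0, b at level 85, c1, c2 at level 90) : ram_scope.
Notation "'IF' b 'THEN' c1 'FI'" := (If b c1 Skip)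
  (at level 0, b at level 85, c1 at level 90) : ram_scope.
Notation "'WHILE' b 'DO' c 'OD'" := (While b c)
  (at level 0, b at level 85, c at level 90) : ram_scope.

(** * The greedy algorithm as a machine program

   Input: Rm holds the number m of edges; the edges are 0, ..., m - 1; edge i
   joins the nodes Aeu[i] and Aev[i], and its intervals are [Ais[k], Aif[k])
   for Aib[i] <= k < Aib[i] + Ail[i].

   Working data: E' is the set of the i < m with Aalive[i] = 1, and Rr holds
   |E'|. For i in E', Anum[i] is the overlapping number of i with respect to
   E', and its set of overlapping edges is stored in
   Aadj[Abase[i]], ..., Aadj[Abase[i] + Anum[i] - 1].

   Output: M is Aout[0], ..., Aout[k - 1] for k the final content of Rk. *)

Local Open Scope ram_scope.

Definition share_endpoint : bexp :=
  (Aeu.[Ri] == Aeu.[Rj]) || (Aeu.[Ri] == Aev.[Rj]) ||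
  (Aev.[Ri] == Aeu.[Rj]) || (Aev.[Ri] == Aev.[Rj]).

(* Sets Ro to 1 if edges Ri and Rj exist at a common timestep, and to 0
   otherwise, by a simultaneous traversal of the two lists of intervals. *)
Definition common_timestep : cmd :=
  Ro ::= 0;;
  Ra ::= Aib.[Ri];; Raend ::= Ra + Ail.[Ri];;
  Rb ::= Aib.[Rj];; Rbend ::= Rb + Ail.[Rj];;
  WHILE (Ro == 0) && (Ra < Raend) && (Rb < Rbend) DO
    IF Aif.[Ra] <= Ais.[Rb] THEN Ra ::= Ra + 1
    ELSE
      IF Aif.[Rb] <= Ais.[Ra] THEN Rb ::= Rb + 1
      ELSE Ro ::= 1 FI
    FI
  OD.

Definition compute_overlapping : cmd :=
  Rp ::= 0;; Ri ::= 0;;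
  WHILE Ri < Rm DO
    Aalive.[Ri] ::= 1;; Abase.[Ri] ::= Rp;; Anum.[Ri] ::= 0;;
    Rj ::= 0;;
    WHILE Rj < Rm DO
      IF (Ri != Rj) && share_endpoint THEN
        common_timestep;;
        IF Ro == 1 THEN
          Aadj.[Rp] ::= Rj;; Rp ::= Rp + 1;;
          Anum.[Ri] ::= Anum.[Ri] + 1
        FI
      FI;;
      Rj ::= Rj + 1
    OD;;
    Ri ::= Ri + 1
  OD.

(* Sets Re to an element of E' of minimum overlapping number; [Flip] decides
   between the current candidate and a new one with the same number. *)
Definition select_minimum : cmd :=
  Re ::= Rm;; Ri ::= 0;;
  WHILE Ri < Rm DO
    IF Aalive.[Ri] == 1 THEN
      IF Re == Rm THEN Re ::= Ri
      ELSE
        IF Anum.[Ri] < Anum.[Re] THEN Re ::= Ri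
        ELSE
          IF Anum.[Ri] == Anum.[Re] THEN
            Flip Rc;;
            IF Rc == 1 THEN Re ::= Ri FI
          FI
        FI
      FI
    FI;;
    Ri ::= Ri + 1
  OD.

Definition remove_selected : cmd :=
  Aalive.[Re] ::= 0;; Rr ::= Rr - 1;;
  Rj ::= 0;;
  WHILE Rj < Anum.[Re] DO
    Aalive.[Aadj.[Abase.[Re] + Rj]] ::= 0;; Rr ::= Rr - 1;;
    Rj ::= Rj + 1
  OD.

(* Deletes Rx from the set of overlapping edges of Ry. *)
Definition delete_from_set : cmd :=
  Rz ::= 0;;
  WHILE (Rz < Anum.[Ry]) && (Aadj.[Abase.[Ry] + Rz] != Rx) DO
    Rz ::= Rz + 1
  OD;;
  Anum.[Ry] ::= Anum.[Ry] - 1;;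
  Aadj.[Abase.[Ry] + Rz] ::= Aadj.[Abase.[Ry] + Anum.[Ry]].

(* Deletes every edge that has just been removed from the sets of overlapping
   edges of the remaining ones. *)
Definition update_overlapping : cmd :=
  Rj ::= 0;;
  WHILE Rj < Anum.[Re] DO
    Rx ::= Aadj.[Abase.[Re] + Rj];;
    Rq ::= 0;;
    WHILE Rq < Anum.[Rx] DO
      Ry ::= Aadj.[Abase.[Rx] + Rq];;
      IF Aalive.[Ry] == 1 THEN delete_from_set FI;;
      Rq ::= Rq + 1
    OD;;
    Rj ::= Rj + 1
  OD.

Definition greedy_program : cmd :=
  compute_overlapping;;
  Rk ::= 0;; Rr ::= Rm;;
  WHILE 0 < Rr DO
    select_minimum;;
    Aout.[Rk] ::= Re;; Rk ::= Rk + 1;;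
    remove_selected;;
    update_overlapping
  OD.

Local Close Scope ram_scope.

(* Nodes and edges are numbered arbitrarily by [vid] and [eid]; registers and
   array cells other than the input ones, and the coins, are arbitrary. *)
Definition encodes (V E : finType) (T : nat) (G : temporal_graph V E T)
    (vid : V -> nat) (eid : E -> 'I_#|E|) (s : store) : Prop :=
  [/\ injective vid, injective eid, reg s Rm = #|E|,
      forall e, exists u v,
        [/\ ends G e = [set u; v], mem s Aeu (eid e) = vid u
          & mem s Aev (eid e) = vid v]
    & forall e,
        ivals G e = [seq (mem s Ais k, mem s Aif k)
                    | k <- iota (mem s Aib (eid e)) (mem s Ail (eid e))]].

Definition outputs (E : finType) (eid : E -> 'I_#|E|) (s : store)
    (M : {set E}) : Prop :=
  exists l : seq E,
    [/\ uniq l, M = [set e in l]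
      & [seq mem s Aout k | k <- iota 0 (reg s Rk)]
        = [seq (eid e : nat) | e <- l]].

(* Main.v *)
From mathcomp Require Import all_boot zify.
Require Import Defs.

(* The greedy output is maximal because an edge only leaves E' by entering M or
   by overlapping an edge that enters M. For the running time, every command is
   executed against a time budget that also serves as termination measure. The
   initial computation inspects all pairs of edges, but traverses interval lists
   (of at most T intervals each) only for the at most 2 Delta edges that share an
   endpoint with a given one. In the main loop each of the at most m rounds pays
   O(m) for the selection, and each removed edge pays O(Delta^2) once for its
   deletion from at most 2 Delta sets of at most 2 Delta elements; so a
   potential linear in |E'| bounds the remaining time. *)

Set Implicit Arguments.
Unset Strict Implicit.
Unset Printing Implicit Defensive.

(** * Maximality of greedy outputs, and how many edges can touch a given edge *)

Section Maximality.
Variables (V E : finType) (T : nat) (G : temporal_graph V E T).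
Implicit Types (e f : E) (M : {set E}).

Lemma overlap_sym : symmetric (overlap G).
Proof.
move=> e f; rewrite /overlap eq_sym setIC; congr [&& _, _ & _].
by apply: eq_existsb => t; rewrite andbC.
Qed.

Lemma overlap_irr : irreflexive (overlap G).
Proof. by move=> e; rewrite /overlap eqxx. Qed.

Lemma timed_matchingP M :
  reflect {in M &, forall e f, ~~ overlap G e f} (timed_matching G M).
Proof.
apply: (iffP forall_inP) => [h e f eM fM | h e eM].
  exact: (forall_inP (h e eM)).
by apply/forall_inP => f fM; apply: h.
Qed.

(** The hypotheses on [M] and [E'] are the loop invariant, carried through the induction. An edge
    leaves [E'] only together with an edge of [M] that blocks it, so once [E'] is empty everything
    outside [M] is blocked. *)
Lemma greedy_from_maximal (E' M M' : {set E}) :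
    greedy_from G E' M M' ->
    timed_matching G M ->
    {in E' & M, forall e f, ~~ overlap G e f} ->
    (forall e, e \notin E' -> e \in M \/ exists2 f, f \in M & overlap G e f) ->
  maximal_timed_matching G M'.
Proof.
elim=> {E' M M'} [M | E' M M' e eE' _ _ IH] mM dE' cM.
  split=> // e eM; apply/negP => /timed_matchingP meM.
  have [|/negPf|[f fM ef]] := cM e; rewrite ?inE ?(negPf eM) //.
  by move/negP: (meM e f (setU11 _ _) (setU1r _ fM)); apply.
apply: IH.
- apply/timed_matchingP => f g.
  case/setU1P=> [->|fM]; case/setU1P=> [->|gM]; rewrite ?overlap_irr //.
  + exact: dE'.
  + by rewrite overlap_sym; apply: dE'.
  + exact: (timed_matchingP _ mM).
- move=> f g; rewrite !inE => /andP[nf fE'] /orP[/eqP->|gM]; last exact: dE'.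
  by move: nf; rewrite fE' negb_or overlap_sym => /andP[].
- move=> f; rewrite !inE negb_and negbK.
  case/orP=> [/orP[->|/andP[fE' ef]]|fE']; first by left.
  + by right; exists e; rewrite ?inE ?eqxx // overlap_sym.
  + have [fM|[g gM fg]] := cM f fE'; first by left; rewrite fM orbT.
    by right; exists g; rewrite ?inE ?gM ?orbT.
Qed.

Lemma greedy_output_maximal M :
  greedy_output G M -> maximal_timed_matching G M.
Proof.
move=> /greedy_from_maximal; apply.
- by apply/timed_matchingP => e f; rewrite inE.
- by move=> e f _; rewrite inE.
- by move=> e; rewrite inE.
Qed.

(** Removing [u] from the two endpoints leaves the other endpoint, a neighbour of [u] that
    determines the edge by [ends_inj]. *)
Lemma card_incident_edges u : #|[set e | u \in ends G e]| <= degree G u.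
Proof.
pose rest (e : E) := ends G e :\ u.
have rest_inj : {in [set e | u \in ends G e] &, injective rest}.
  move=> e f; rewrite !inE => ue uf eq_rest.
  by apply: (@ends_inj _ _ _ G); rewrite -(setD1K ue) -(setD1K uf) -!/(rest _) eq_rest.
rewrite -(card_in_imset rest_inj) /degree -(card_imset _ (@set1_inj V)).
apply: subset_leq_card; apply/subsetP => _ /imsetP[e + ->]; rewrite inE => ue.
have /eqP/cards1P[v rest_v] : #|rest e| = 1.
  by move: (cardsD1 u (ends G e)); rewrite ue ends_card => -[].
rewrite rest_v; apply: imset_f; rewrite inE; apply/existsP; exists e.
by rewrite -(setD1K ue) -/(rest e) rest_v.
Qed.

(** Such an edge contains one of the two endpoints of [e], and each endpoint lies on at most Delta
    edges. *)
Lemma card_adjacent_edges e :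
  #|[set f | ends G e :&: ends G f != set0]| <= (max_degree G).*2.
Proof.
have /eqP/cards2P[u [v [_ def_e]]] := ends_card G e.
have inc_le w : #|[set f | w \in ends G f]| <= max_degree G.
  exact: leq_trans (card_incident_edges w) (leq_bigmax w).
rewrite -addnn; apply: leq_trans (leq_add (inc_le u) (inc_le v)).
apply: leq_trans (leq_card_setU _ _); apply: subset_leq_card.
apply/subsetP => f; rewrite !inE def_e => /set0Pn[w].
by rewrite !inE => /andP[/orP[] /eqP-> ->]; rewrite ?orbT.
Qed.

End Maximality.

(** * Intervals *)

(** Nonempty half-open intervals intersect exactly when each starts before the other ends. *)
Definition interval_meet (i j : nat * nat) : bool := (j.1 < i.2) && (i.1 < j.2).

Lemma pairwise_intervals (s : seq (nat * nat)) :
    sorted ltn (flatten [seq [:: i.1; i.2] | i <- s]) ->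
  all (fun i => i.1 < i.2) s /\ pairwise (fun i j => i.2 < j.1) s.
Proof.
rewrite (sorted_pairwise ltn_trans); elim: s => //= -[a b] s IH /=.
case/and3P=> /andP[lt_ab _] lt_b /IH[-> ->]; rewrite lt_ab; split=> //.
rewrite andbT; apply/allP => -[c d] cd_s /=; apply: (allP lt_b).
by apply/flatten_mapP; exists (c, d); rewrite ?inE ?eqxx.
Qed.

(** Disjoint intervals each take up at least one integer below [T]. The induction proves
    [size s <= T - a] for any lower bound [a] of the starting points, hence the detour through
    [T - 0]. *)
Lemma size_intervals (s : seq (nat * nat)) T :
    sorted ltn (flatten [seq [:: i.1; i.2] | i <- s]) ->
    (forall i, i \in s -> i.2 <= T) -> size s <= T.
Proof.
move=> /pairwise_intervals[]; rewrite -[T in _ <= T]subn0.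
have: all (fun i => 0 <= i.1) s by apply/allP.
elim: s 0 => //= -[c d] s IH a /andP[/= ac _] /andP[cd ss] /andP[ds pw] le_T.
have dT : d <= T by apply: (le_T (c, d)); rewrite inE eqxx.
have := IH d (sub_all _ ds) ss pw; rewrite /=.
have sT i : i \in s -> i.2 <= T by move=> i_s; apply: le_T; rewrite inE i_s orbT.
by move=> /(_ (fun i => @ltnW _ _) sT); lia.
Qed.

(** The order condition on an interval list, restated for a block of positions in two arrays, which
    is how the machine stores the list. *)
Definition sorted_intervals (st fi : nat -> nat) (a n : nat) : Prop :=
  (forall k, a <= k < a + n -> st k < fi k) /\
  (forall k l, a <= k -> k < l < a + n -> fi k < st l).

Lemma sorted_intervals_map st fi a n :
    sorted ltn (flatten [seq [:: i.1; i.2] | i <- [seq (st k, fi k) | k <- iota a n]]) ->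
  sorted_intervals st fi a n.
Proof.
case/pairwise_intervals; rewrite all_map pairwise_map => /allP lt_sf pw.
split=> [k k_an | k l ak /andP[kl l_an]]; first by apply: lt_sf; rewrite mem_iota.
move/(pairwiseP 0): pw => /(_ (k - a) (l - a)).
rewrite !inE size_iota !nth_iota ?subnKC; try lia.
by apply; lia.
Qed.

Lemma sorted_intervals_le st fi a n k l :
  sorted_intervals st fi a n -> a <= k <= l -> l < a + n -> st k <= st l.
Proof.
move=> [lt_sf lt_fs] akl ln; have [->//|kl] := eqVneq k l.
have := lt_fs k l; have := lt_sf k; lia.
Qed.

(** * Executions with a time budget *)

(* [Q] receives the final store and the part of the budget [n] that is left. *)
Definition runs (c : cmd) (s : store) (n : nat) (Q : store -> nat -> Prop) : Prop :=
  exists t s', [/\ exec c s t s', t <= n & Q s' (n - t)].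

Section RunsRules.
Implicit Types (c : cmd) (s : store) (n : nat) (Q : store -> nat -> Prop).

Lemma runs_assign x e s n Q :
  acost e < n -> Q (set_reg s x (aval s e)) (n - (acost e).+1) ->
  runs (Assign x e) s n Q.
Proof. by move=> en q; do 2 eexists; split; [constructor| |]. Qed.

Lemma runs_put a e1 e2 s n Q :
  acost e1 + acost e2 < n ->
  Q (set_mem s a (aval s e1) (aval s e2)) (n - (acost e1 + acost e2).+1) ->
  runs (Put a e1 e2) s n Q.
Proof. by move=> en q; do 2 eexists; split; [constructor| |]. Qed.

Lemma runs_flip x s n Q :
  0 < n ->
  Q (set_reg (Store (reg s) (mem s) (fun k => coins s k.+1)) x (coins s 0)) (n - 1) ->
  runs (Flip x) s n Q.
Proof. by move=> en q; do 2 eexists; split; [constructor| |]. Qed.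

Lemma runs_skip s n Q : 0 < n -> Q s (n - 1) -> runs Skip s n Q.
Proof. by move=> en q; do 2 eexists; split; [constructor| |]. Qed.

Lemma runs_seq c1 c2 s n Q :
  runs c1 s n (fun s1 n1 => runs c2 s1 n1 Q) -> runs (Seq c1 c2) s n Q.
Proof.
move=> [t1 [s1 [ex1 le1 [t2 [s2 [ex2 le2 q]]]]]].
exists (t1 + t2), s2; split; [exact: exec_seq ex1 ex2 | lia | by rewrite subnDA].
Qed.

Lemma runs_if b c1 c2 s n Q :
    bcost b < n ->
    (bval s b -> runs c1 s (n - (bcost b).+1) Q) ->
    (~~ bval s b -> runs c2 s (n - (bcost b).+1) Q) ->
  runs (If b c1 c2) s n Q.
Proof.
move=> bn; case: (boolP (bval s b)) => bs => [/(_ isT) h _ | _ /(_ isT) h];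
  have [t [s' [ex le q]]] := h; exists (bcost b + t).+1, s';
  split; try lia; try by rewrite -addSn subnDA.
- exact: exec_if_true.
- exact: exec_if_false.
Qed.

(* The budget is the termination measure: every test consumes some of it. *)
Lemma runs_while (I : store -> nat -> Prop) b c s n Q :
    I s n ->
    (forall s1 n1, I s1 n1 -> bcost b < n1) ->
    (forall s1 n1, I s1 n1 -> bval s1 b -> runs c s1 (n1 - (bcost b).+1) I) ->
    (forall s1 n1, I s1 n1 -> ~~ bval s1 b -> Q s1 (n1 - (bcost b).+1)) ->
  runs (While b c) s n Q.
Proof.
move=> + Ib Ic IQ; elim/ltn_ind: n s => n IH s Isn.
case: (boolP (bval s b)) => bs; last first.
  exists (bcost b).+1, s; split; [exact: exec_while_stop | exact: Ib Isn | exact: IQ].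
have bn := Ib _ _ Isn.
have [t1 [s1 [ex1 le1 I1]]] := Ic _ _ Isn bs.
have [|t2 [s2 [ex2 le2 q]]] := IH (n - (bcost b).+1 - t1) _ s1 I1; first lia.
exists (bcost b + t1 + t2).+1, s2; split; first exact: exec_while_loop ex1 ex2.
  lia.
by rewrite (_ : n - _ = n - (bcost b).+1 - t1 - t2) //; lia.
Qed.

End RunsRules.

(** The lower bound on the remaining budget usually suffices alone, so it is tried first with all
    other hypotheses cleared. *)
Ltac budget :=
  rewrite /=;
  first [ match goal with H : is_true (_ <= ?n) |- context [?n] => clear -H; lia end
        | lia ].

Ltac step :=
  match goal with
  | |- runs (Seq _ _) _ _ _ => apply: runs_seq
  | |- runs (Assign _ _) _ _ _ => apply: runs_assign; [budget | ]
  | |- runs (Put _ _ _) _ _ _ => apply: runs_put; [budget | ]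
  | |- runs (Flip _) _ _ _ => apply: runs_flip; [budget | ]
  | |- runs Skip _ _ _ => apply: runs_skip; [budget | ]
  | |- runs (If _ _ _) _ _ _ => apply: runs_if; [budget | | ]
  end.

(* The loop invariant: all pairs of meeting intervals lie in the part of the two
   lists that is not traversed yet. *)
Lemma common_timestep_runs s n k0 (Q : store -> nat -> Prop) :
  let st := mem s Ais in let fi := mem s Aif in
  let a := mem s Aib (reg s Ri) in let la := mem s Ail (reg s Ri) in
  let b := mem s Aib (reg s Rj) in let lb := mem s Ail (reg s Rj) in
    sorted_intervals st fi a la -> sorted_intervals st fi b lb ->
    40 * (la + lb) + 100 + k0 <= n ->
    (forall s' k, mem s' = mem s ->
       [/\ reg s' Rm = reg s Rm, reg s' Ri = reg s Ri, reg s' Rj = reg s Rj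
         & reg s' Rp = reg s Rp] ->
       reg s' Ro = has (fun k => has (fun l => interval_meet (st k, fi k) (st l, fi l))
                                     (iota b lb)) (iota a la) ->
       k0 <= k -> Q s' k) ->
  runs common_timestep s n Q.
Proof.
move=> st fi a la b lb sa sb le_n HQ; rewrite /common_timestep.
pose meet k l := interval_meet (st k, fi k) (st l, fi l).
do 10 (try step).
pose I s1 n1 :=
  [/\ mem s1 = mem s,
      [/\ reg s1 Rm = reg s Rm, reg s1 Ri = reg s Ri, reg s1 Rj = reg s Rj
        & reg s1 Rp = reg s Rp],
      [/\ a <= reg s1 Ra, reg s1 Ra <= reg s1 Raend, b <= reg s1 Rb,
          reg s1 Rb <= reg s1 Rbend & reg s1 Raend = a + la /\ reg s1 Rbend = b + lb],
      [\/ reg s1 Ro = 0 /\ (forall k l, a <= k < a + la -> b <= l < b + lb -> meet k l ->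
                             reg s1 Ra <= k /\ reg s1 Rb <= l)
        | reg s1 Ro = 1 /\ exists k l,
            [/\ a <= k < a + la, b <= l < b + lb & meet k l]]
    & 40 * (reg s1 Raend - reg s1 Ra + (reg s1 Rbend - reg s1 Rb)) + 30 * (1 - reg s1 Ro)
      + 30 + k0 <= n1].
(* Each iteration either advances one of the two pointers, paid by the 40 units of the interval left
   behind, or sets [Ro], paid by the 30 units attached to [1 - reg s1 Ro]. *)
apply: (runs_while (I := I)).
- split=> //=; rewrite -?/a -?/la -?/b -?/lb; try (by split; lia); try lia.
  by left; split=> // k l; lia.
- by move=> s1 n1 [_ _ _ _ ?] /=; lia.
- move=> s1 n1 [Im Ir Ia Io In] /= /andP[/andP[/eqP Ro0 lt_a] lt_b].
  case: Io => [[_ Io]|[]]; last by rewrite Ro0.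
  have le_a k : reg s1 Ra <= k < a + la -> st (reg s1 Ra) <= st k.
    by move=> k_le; apply: (sorted_intervals_le sa); case: Ia; lia.
  have le_b l : reg s1 Rb <= l < b + lb -> st (reg s1 Rb) <= st l.
    by move=> k_le; apply: (sorted_intervals_le sb); case: Ia; lia.
  case: Ia => a_le Ra_le b_le Rb_le [Ea Eb].
  step=> /=; rewrite Im -/fi -/st => cmp1; [step | step=> /=; rewrite Im -/fi -/st => cmp2; step].
  + split=> //=; try (by split; lia); try lia.
    left; split=> // k l ka lb_ mkl; have [kle lle] := Io _ _ ka lb_ mkl; split=> //.
    case: (ltngtP k (reg s1 Ra)) => [||Ek]; try lia.
    by move: mkl; rewrite /meet /interval_meet /= Ek; have := le_b l; lia.
  + split=> //=; try (by split; lia); try lia.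
    left; split=> // k l ka lb_ mkl; have [kle lle] := Io _ _ ka lb_ mkl; split=> //.
    case: (ltngtP l (reg s1 Rb)) => [||El]; try lia.
    by move: mkl; rewrite /meet /interval_meet /= El; have := le_a k; lia.
  + split=> //=; try (by split; lia); try lia.
    right; split=> //; exists (reg s1 Ra), (reg s1 Rb); split; try lia.
    by rewrite /meet /interval_meet /=; lia.
- move=> s1 n1 [Im Ir [a_le Ra_le b_le Rb_le [Ea Eb]] Io In] /= stop.
  apply: HQ => //; last lia.
  case: Io => [[Ro0 Io]|[-> [k [l [ka lb_ mkl]]]]].
    rewrite Ro0; apply/esym/eqP; rewrite eqb0; apply/hasP => -[k]; rewrite mem_iota => ka.
    by case/hasP=> l; rewrite mem_iota => lb_ /(Io _ _ ka lb_); lia.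
  apply/esym/eqP; rewrite eqb1; apply/hasP; exists k; rewrite ?mem_iota //.
  by apply/hasP; exists l; rewrite ?mem_iota.
Qed.

(** * The sets of overlapping edges *)

Definition adjl (s : store) (i : nat) : seq nat :=
  mkseq (fun k => mem s Aadj (mem s Abase i + k)) (mem s Anum i).

Lemma size_adjl s i : size (adjl s i) = mem s Anum i.
Proof. exact: size_mkseq. Qed.

Lemma nth_adjl s i k :
  k < mem s Anum i -> nth 0 (adjl s i) k = mem s Aadj (mem s Abase i + k).
Proof. exact: nth_mkseq. Qed.

Lemma eq_adjl s s' i :
    mem s' Abase i = mem s Abase i -> mem s' Anum i = mem s Anum i ->
    (forall k, mem s Abase i <= k < mem s Abase i + mem s Anum i ->
       mem s' Aadj k = mem s Aadj k) ->
  adjl s' i = adjl s i.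
Proof.
move=> eq_base eq_num eq_adj; apply: (eq_from_nth (x0 := 0)); rewrite !size_adjl //.
by move=> k ltk; rewrite !nth_adjl ?eq_base -?eq_num // eq_adj //; lia.
Qed.

Lemma iota_ltn j m : j < m -> iota j (m - j) = j :: iota j.+1 (m - j.+1).
Proof. by move=> ltjm; rewrite -subnSK. Qed.

Lemma iota0S j : iota 0 j.+1 = rcons (iota 0 j) j.
Proof. by rewrite -addn1 iotaD cats1. Qed.

(** Overlap is first expressed through raw memory contents, so that the program can be analysed
    without the graph; [store_overlap_eid] translates it back. *)
Definition shares (s : store) (i j : nat) : bool :=
  (mem s Aeu i == mem s Aeu j) || (mem s Aeu i == mem s Aev j) ||
  (mem s Aev i == mem s Aeu j) || (mem s Aev i == mem s Aev j).

Definition meets (s : store) (i j : nat) : bool :=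
  has (fun k => has (fun l => interval_meet (mem s Ais k, mem s Aif k)
                                            (mem s Ais l, mem s Aif l))
                    (iota (mem s Aib j) (mem s Ail j)))
      (iota (mem s Aib i) (mem s Ail i)).

Definition store_overlap (s : store) (i j : nat) : bool :=
  (i != j) && shares s i j && meets s i j.

Definition same_input (s s' : store) : Prop :=
  [/\ mem s' Aeu = mem s Aeu, mem s' Aev = mem s Aev, mem s' Ais = mem s Ais,
      mem s' Aif = mem s Aif
    & [/\ mem s' Aib = mem s Aib, mem s' Ail = mem s Ail & reg s' Rm = reg s Rm]].

Section ComputeOverlapping.
Variables (s0 : store) (T D : nat).
Let m := reg s0 Rm.
Let ov := store_overlap s0.

Hypothesis sortedI : forall i, i < m ->
  sorted_intervals (mem s0 Ais) (mem s0 Aif) (mem s0 Aib i) (mem s0 Ail i).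
Hypothesis len_le : forall i, i < m -> mem s0 Ail i <= T.
Hypothesis shares_le : forall i, i < m -> count (shares s0 i) (iota 0 m) <= D.

Definition computed_upto (s : store) (i : nat) : Prop :=
  [/\ forall k, k < i -> mem s Aalive k = 1,
      forall k, k < i -> adjl s k = [seq j <- iota 0 m | ov k j]
    & forall k l, k < l -> l < i -> mem s Abase k + mem s Anum k <= mem s Abase l].

(** Traversing two lists of at most [T] intervals takes at most [40 * (T + T) + 100] units; the rest
    is room for the surrounding commands. *)
Let W := 80 * T + 200.

(** The row of [i] is charged 60 units for every [j], but [W] only for the at most [D] indices that
    share an endpoint with [i]. Here and below [k0] is the budget reserved for what follows. *)
Lemma compute_overlapping_runs n k0 (Q : store -> nat -> Prop) :
    m * (60 * m + D * W + 60) + 60 + k0 <= n ->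
    (forall s' k, reg s' Rm = m -> computed_upto s' m -> k0 <= k -> Q s' k) ->
  runs compute_overlapping s0 n Q.
Proof.
move=> le_n HQ; rewrite /compute_overlapping.
do 4 (try step).
pose I s n1 := [/\ same_input s0 s, reg s Ri <= m, computed_upto s (reg s Ri),
  forall k, k < reg s Ri -> mem s Abase k + mem s Anum k <= reg s Rp
  & (m - reg s Ri) * (60 * m + D * W + 60) + 30 + k0 <= n1].
apply: (runs_while (I := I)).
- by split=> //=; rewrite ?subn0; lia.
- by move=> s n1 [_ _ _ _] /=; lia.
- move=> s n1 [Isame _ [Ialive Iadj Ibase] Ip In] /=.
  move E: (reg s Ri) => i.
  case: (Isame) => _ _ _ _ [_ _ Em]; rewrite Em -/m => ltim.
  have En : 60 * m + D * W + 60 + (m - i.+1) * (60 * m + D * W + 60) + 30 + k0 <= n1.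
    by move: In; rewrite E -(subnSK ltim) mulSn; lia.
  move: En; set R := (m - i.+1) * _ => En.
  do 9 (try step).
  pose J s1 n2 := [/\ same_input s0 s1, reg s1 Ri = i, reg s1 Rj <= m,
    [/\ forall k, k <= i -> mem s1 Aalive k = 1,
      forall k, k < i -> adjl s1 k = [seq j <- iota 0 m | ov k j],
      forall k l, k < l -> l <= i -> mem s1 Abase k + mem s1 Anum k <= mem s1 Abase l,
      mem s1 Abase i + mem s1 Anum i = reg s1 Rp
      & adjl s1 i = [seq j <- iota 0 (reg s1 Rj) | ov i j]]
    & (m - reg s1 Rj) * 60 + count (shares s0 i) (iota (reg s1 Rj) (m - reg s1 Rj)) * W
       + 20 + R + 30 + k0 <= n2].
  apply: (runs_while (I := J)).
  + split=> //=; rewrite ?E ?eqxx.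
    * split=> //=.
      -- by move=> k lek; case: eqVneq => // nk; apply: Ialive; lia.
      -- move=> k ltk; rewrite -(Iadj k); last lia.
         by apply: eq_adjl => //=; rewrite ?E; case: eqVneq => //; lia.
      -- move=> k l ltkl lel; case: (eqVneq k i) => [|nk]; first lia.
         case: (eqVneq l i) => nl; first by apply: Ip; lia.
         by apply: Ibase; lia.
      -- by rewrite addn0.
      -- by rewrite /adjl /= ?E eqxx.
    * rewrite subn0; have := leq_mul (shares_le ltim) (leqnn W); lia.
  + by move=> s1 n2 [_ _ _ _] /=; lia.
  + move=> s1 n2 [[Jeu Jev Jis Jif [Jib Jil Jm]] Ji _ [Jalive Jadj Jbase Jp Jl] Jn].
    move Ej: (reg s1 Rj) Jl Jn => j Jl Jn.
    rewrite /= Ej Jm -/m => ltjm.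
    move: Jn; rewrite (iota_ltn ltjm) /= -(subnSK ltjm) => Jn.
    (* Common end of the three branches (no shared endpoint, no common timestep, overlap): they
       differ only in whether [j] is appended to the list of [i]. *)
    have next s2 : same_input s0 s2 -> reg s2 Ri = i -> reg s2 Rj = j.+1 ->
      [/\ forall k, k <= i -> mem s2 Aalive k = 1,
      forall k, k < i -> adjl s2 k = [seq j <- iota 0 m | ov k j],
      forall k l, k < l -> l <= i -> mem s2 Abase k + mem s2 Anum k <= mem s2 Abase l,
      mem s2 Abase i + mem s2 Anum i = reg s2 Rp
      & adjl s2 i = if ov i j then rcons (adjl s1 i) j else adjl s1 i] ->
      forall n3, n2 <= n3 + 60 + shares s0 i j * W -> J s2 n3.
      move=> h1 h2 h3 h4 n3 h5; split=> //; rewrite h3 //; last by move: Jn; rewrite mulnDl; lia.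
      by case: h4 => ? ? ? ? ->; split; rewrite // iota0S filter_rcons -Jl.
    have W_le : shares s0 i j -> W + 60 <= n2.
      by move=> sh; move: Jn; rewrite sh mulnDl mul1n; lia.
    have n2_le : 60 <= n2 by lia.
    step; step; last first.
    * rewrite /= Ji Ej Jeu Jev => nsh.
      do 3 (try step); apply: next => //=; rewrite ?Ej ?addn1 //; last lia.
      by split=> //; rewrite /ov /store_overlap /shares (negPf nsh).
    rewrite /= Ji Ej Jeu Jev -/(shares s0 i j) => /andP[nij sh].
    move: (W_le sh); rewrite {1}/W => {}W_le.
    have Li := len_le ltim; have Lj := len_le ltjm.
    step; apply: (common_timestep_runs (k0 := n2 - 40 - (80 * T + 100))).
    * by rewrite Jis Jif Jib Jil Ji; apply: sortedI.
    * by rewrite Jis Jif Jib Jil Ej; apply: sortedI.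
    * by rewrite Ji Ej Jil; lia.
    move=> s2 n3 E2 [E2m E2i E2j E2p] E2o n3_le.
    move: E2o; rewrite Ji Ej Jis Jif Jib Jil -/(meets s0 i j) => E2o.
    step; rewrite /= E2o eqb1 => mt; last first.
    * do 3 (try step); apply: next => //=; rewrite ?E2 ?E2m ?E2i ?E2j ?E2p ?Ej ?addn1 //.
      -- by split=> //=; rewrite ?E2 // ?E2m.
      -- split=> //.
        ++ by move=> k ltk; rewrite -(Jadj _ ltk); apply: eq_adjl; rewrite /= ?E2.
        ++ rewrite /ov /store_overlap (negPf mt) andbF.
           by apply: eq_adjl; rewrite /= ?E2.
      -- by rewrite sh /W; lia.
    do 7 (try step); apply: next => //=; rewrite ?E2 ?E2m ?E2i ?E2j ?E2p ?Ej ?addn1 //.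
    * by split=> //=; rewrite ?E2 // ?E2m.
    * rewrite Ji eqxx; split=> //=.
      (* The new entry is written at [Rp], the end of the block of [i], which lies beyond all
         earlier blocks. *)
      -- move=> k ltk; rewrite -(Jadj _ ltk); apply: eq_adjl => /=; rewrite ?E2 //.
         ++ by case: eqVneq => //; lia.
         ++ move=> l l_k; case: eqVneq => //.
            by have := Jbase k i ltk (leqnn _); lia.
      -- move=> k l ltkl lel; case: eqVneq => [|_]; first lia.
         exact: Jbase.
      -- lia.
      -- rewrite /ov /store_overlap nij sh mt /=.
         rewrite /adjl /= E2 eqxx mkseqS Jp eqxx; congr rcons.
         apply: (@eq_from_nth _ 0); rewrite ?size_mkseq // => k ltk.
         by rewrite !nth_mkseq //; case: eqVneq => //; lia.
    * by rewrite sh /W; lia.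
  + move=> s1 n2 [Js Ji Jj [Jalive Jadj Jbase Jp Jl] Jn] /= stop.
    have Ej : reg s1 Rj = m by case: Js => _ _ _ _ [_ _ Jm]; move: stop; rewrite Jm -/m; lia.
    step; split=> //=; rewrite ?Ji ?addn1 //.
    * split=> //= k; rewrite ltnS leq_eqVlt (_ : adjl _ k = adjl s1 k) //.
      by case/orP=> [/eqP->|/Jadj//]; rewrite Jl Ej.
    * move=> k; rewrite ltnS leq_eqVlt => /orP[/eqP->|ltk]; first by rewrite Jp.
      by have := Jbase k i ltk (leqnn _); lia.
    * lia.
- move=> s n1 [Is le_m Ic _ In] /= stop.
  have Em : reg s Rm = m by case: Is => _ _ _ _ [].
  have Ei : reg s Ri = m by move: stop; rewrite Em; lia.
  by apply: HQ => //; [rewrite -Ei | lia].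
Qed.

End ComputeOverlapping.

(** * The loop of the greedy algorithm *)

Definition alive (s : store) (i : nat) : bool := mem s Aalive i == 1.

(** In the main loop blocks never move and only get shorter, so this layout survives every
    deletion. *)
Definition disjoint_blocks (s : store) (m : nat) : Prop :=
  forall i j, i < j -> j < m -> mem s Abase i + mem s Anum i <= mem s Abase j.

Lemma select_minimum_runs s n k0 (Q : store -> nat -> Prop) :
  let m := reg s Rm in
    70 * m + 50 + k0 <= n ->
    (exists2 i, i < m & alive s i) ->
    (forall s' k, mem s' = mem s ->
       [/\ reg s' Rm = m, reg s' Rk = reg s Rk & reg s' Rr = reg s Rr] ->
       reg s' Re < m -> alive s (reg s' Re) ->
       (forall i, i < m -> alive s i -> mem s Anum (reg s' Re) <= mem s Anum i) ->
       k0 <= k -> Q s' k) ->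
  runs select_minimum s n Q.
Proof.
move=> m le_n [i0 lti0 alive0] HQ; rewrite /select_minimum.
do 4 (try step).
(* The value [m] is no edge; it marks that no alive edge has been seen so far. Otherwise [e] is the
   running minimum. *)
pose best e i := [\/ e = m /\ (forall j, j < i -> ~~ alive s j)
  | [/\ e < m, alive s e
      & forall j, j < i -> alive s j -> mem s Anum e <= mem s Anum j]].
pose I s1 n1 := [/\ mem s1 = mem s,
  [/\ reg s1 Rm = m, reg s1 Rk = reg s Rk & reg s1 Rr = reg s Rr],
  reg s1 Ri <= m, best (reg s1 Re) (reg s1 Ri)
  & 70 * (m - reg s1 Ri) + 20 + k0 <= n1].
apply: (runs_while (I := I)).
- by split=> //=; [left | rewrite subn0; lia].
- by move=> s1 n1 [_ _ _ _] /=; lia.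
- move=> s1 n1 [Im [Irm Irk Irr] Ii Ib In]; rewrite /= Irm => lt_im.
  move Ei: (reg s1 Ri) Ib lt_im In => i Ib lt_im In.
  have next s2 n2 : mem s2 = mem s ->
    [/\ reg s2 Rm = m, reg s2 Rk = reg s Rk & reg s2 Rr = reg s Rr] ->
    reg s2 Ri = i -> best (reg s2 Re) i.+1 -> n1 <= n2 + 60 ->
    runs (Assign Ri (Add Ri 1)) s2 n2 I.
    by move=> h1 h2 h3 h4 h5; step; split=> //=; rewrite ?h3 ?addn1 //; lia.
  have best_i : alive s i ->
      (forall j, j < i -> alive s j -> mem s Anum i <= mem s Anum j) -> best i i.+1.
    move=> ai mi; right; split=> // j; rewrite ltnS leq_eqVlt => /orP[/eqP->//|].
    exact: mi.
  have best_e e : best e i -> e != m ->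
      (alive s i -> mem s Anum e <= mem s Anum i) -> best e i.+1.
    case=> [[->]|[em ae me] _ le_ei]; first by rewrite eqxx.
    by right; split=> // j; rewrite ltnS leq_eqVlt => /orP[/eqP->//|]; apply: me.
  step; step=> /=; rewrite Im Ei -/(alive s i) => ai; last first.
    step; apply: next; rewrite //=; last lia.
    case: Ib => [[Re_m nalive]|[em ae me]]; [left | right]; split=> // j;
      rewrite ltnS leq_eqVlt => /orP[/eqP->|]; rewrite ?(negPf ai) //; first exact: nalive.
    exact: me.
  step=> /=; rewrite Irm => Re_m.
    step; apply: next; rewrite //=; last lia.
    rewrite Ei; apply: best_i => // j ltj aj; case: Ib => [[_ /(_ j ltj)]|[]].
      by rewrite aj.
    by move: Re_m => /eqP->; rewrite ltnn.
  have min_i : mem s Anum i <= mem s Anum (reg s1 Re) -> best i i.+1.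
    move=> le_ie; apply: best_i => // j ltj aj; case: Ib => [[Em]|[_ _ /(_ j ltj aj)]].
      by rewrite Em eqxx in Re_m.
    exact: leq_trans.
  step=> /=; rewrite Im Ei => lt_num.
    step; apply: next; rewrite //=; last lia.
    by rewrite Ei; apply: min_i; lia.
  step=> /=; rewrite Im Ei => eq_num.
    (* On a tie, either outcome of the coin leaves a minimum. *)
    do 2 step; step=> /=; rewrite ?eqb1 => coin; step; apply: next; rewrite //=; try lia.
      by rewrite Ei; apply: min_i; lia.
    by apply: best_e => //; lia.
  by step; apply: next; rewrite //=; [apply: best_e => //; lia | lia].
- move=> s1 n1 [Im [Irm Irk Irr] Ii Ib In]; rewrite /= Irm => stop.
  have Ei : reg s1 Ri = m by lia.
  case: Ib => [[_ /(_ i0)]|[em ae me]]; first by rewrite Ei lti0 alive0 => /(_ isT).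
  by apply: HQ => //; [rewrite -{1}Ei | lia].
Qed.

(** The lists of the removed edges must stay intact in memory, since the update that follows still
    reads them. *)
Lemma remove_selected_runs s n k0 (Q : store -> nat -> Prop) :
  let e := reg s Re in
    40 * mem s Anum e + 50 + k0 <= n ->
    (forall s' k,
       [/\ mem s' Abase = mem s Abase, mem s' Anum = mem s Anum, mem s' Aadj = mem s Aadj
         & mem s' Aout = mem s Aout] ->
       [/\ reg s' Rm = reg s Rm, reg s' Rk = reg s Rk, reg s' Re = e
         & reg s' Rr = reg s Rr - (mem s Anum e).+1] ->
       (forall i, mem s' Aalive i
          = if (i == e) || (i \in adjl s e) then 0 else mem s Aalive i) ->
       k0 <= k -> Q s' k) ->
  runs remove_selected s n Q.
Proof.
move=> e le_n HQ; rewrite /remove_selected; do 6 (try step).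
pose I s1 n1 :=
  [/\ [/\ mem s1 Abase = mem s Abase, mem s1 Anum = mem s Anum, mem s1 Aadj = mem s Aadj
         & mem s1 Aout = mem s Aout],
      [/\ reg s1 Rm = reg s Rm, reg s1 Rk = reg s Rk, reg s1 Re = e
         & reg s1 Rr = reg s Rr - (reg s1 Rj).+1],
      reg s1 Rj <= mem s Anum e,
      forall i, mem s1 Aalive i
         = if (i == e) || (i \in take (reg s1 Rj) (adjl s e)) then 0 else mem s Aalive i
    & 40 * (mem s Anum e - reg s1 Rj) + 30 + k0 <= n1].
apply: (runs_while (I := I)).
- split=> //=; first by move=> i; rewrite take0 in_nil orbF.
  by rewrite subn0; lia.
- by move=> s1 n1 [_ _ _ _] /=; lia.
- move=> s1 n1 [[Ib In Ia Io] [Irm Irk Ire Irr] Ij Ial Ic]; rewrite /= In Ire => ltj.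
  do 5 (try step); split=> //=; try lia.
    by split=> //=; lia.
  move=> i; rewrite Ia Ib Ire addn1 (take_nth 0) ?size_adjl // mem_rcons inE nth_adjl //.
  by case: (i == _) => /=; rewrite ?orbT // Ial.
- move=> s1 n1 [[Ib In Ia Io] [Irm Irk Ire Irr] Ij Ial Ic]; rewrite /= In Ire => stop.
  have Ej : reg s1 Rj = mem s Anum e by lia.
  apply: HQ => //; [by rewrite -Ej | | lia].
  by move=> i; rewrite Ial Ej -size_adjl take_size.
Qed.

Lemma eq_perm (T : eqType) (r1 r2 : seq T) : r1 = r2 -> perm_eq r1 r2.
Proof. by move=> ->. Qed.

(** Deletion by moving the last entry into the gap: the order is lost, but the multiset loses just
    one copy of [f z]. *)
Lemma perm_delete (f : nat -> nat) n z :
    z < n ->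
  perm_eq (mkseq (fun k => if k == z then f n.-1 else f k) n.-1)
          (rem (f z) (mkseq f n)).
Proof.
case: n => // n; rewrite ltnS -pred_Sn => le_zn.
have fz : f z \in mkseq f n.+1 by apply/mapP; exists z; rewrite ?mem_iota.
apply/permP => p; rewrite count_rem fz mkseqS -cats1 count_cat /= addn0.
have [Ez|lt_zn] := eqVneq z n.
  rewrite Ez addnK; congr count; apply: (@eq_from_nth _ 0); rewrite ?size_mkseq //.
  by move=> k ltk; rewrite !nth_mkseq //; case: eqVneq => //; lia.
have {le_zn} lt_zn : z < n by lia.
have -> : mkseq (fun k => if k == z then f n else f k) n = set_nth 0 (mkseq f n) z (f n).
  apply: (@eq_from_nth _ 0) => [|k]; rewrite ?size_set_nth ?size_mkseq; first by lia.
  by move=> ltk; rewrite nth_set_nth /= !nth_mkseq.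
by rewrite count_set_nth_ltn ?size_mkseq // nth_mkseq //; lia.
Qed.

(** The linear search stops at the first position of [x], and [perm_delete] describes the effect.
    The only write to [Aadj] falls into the block of [y], so disjointness of the blocks protects the
    other lists. *)
Lemma delete_from_set_runs m s n k0 (Q : store -> nat -> Prop) :
  let x := reg s Rx in let y := reg s Ry in
    y < m -> disjoint_blocks s m -> x \in adjl s y ->
    40 * mem s Anum y + 60 + k0 <= n ->
    (forall s' k,
       [/\ mem s' Aalive = mem s Aalive & mem s' Aout = mem s Aout] ->
       [/\ reg s' Rm = reg s Rm, reg s' Rk = reg s Rk, reg s' Re = reg s Re
         & [/\ reg s' Rr = reg s Rr, reg s' Rj = reg s Rj, reg s' Rx = reg s Rx
             & reg s' Rq = reg s Rq]] ->
       disjoint_blocks s' m ->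
       perm_eq (adjl s' y) (rem x (adjl s y)) ->
       (forall i, i < m -> i != y -> adjl s' i = adjl s i) ->
       k0 <= k -> Q s' k) ->
  runs delete_from_set s n Q.
Proof.
move=> x y ym dj xy le_n HQ; rewrite /delete_from_set; do 3 (try step).
pose I s1 n1 := [/\ mem s1 = mem s,
  [/\ reg s1 Rm = reg s Rm, reg s1 Rk = reg s Rk, reg s1 Re = reg s Re
         & [/\ reg s1 Rr = reg s Rr, reg s1 Rj = reg s Rj, reg s1 Rx = reg s Rx
             & reg s1 Rq = reg s Rq]] /\ reg s1 Ry = reg s Ry,
  reg s1 Rz <= index x (adjl s y)
  & 40 * (mem s Anum y - reg s1 Rz) + 50 + k0 <= n1].
have lt_index : index x (adjl s y) < mem s Anum y by rewrite -size_adjl index_mem.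
apply: (runs_while (I := I)).
- by split=> //=; lia.
- by move=> s1 n1 [_ _ _] /=; lia.
- move=> s1 n1 [Im [[Irm Irk Ire [Irr Irj Irx Irq]] Iry] Iz In] /=.
  rewrite Im Iry Irx -/x -/y => /andP[ltz neq].
  step; split=> //=; last lia.
  case: (ltngtP (reg s1 Rz) (index x (adjl s y))) Iz => // [|Ez]; first lia.
  by move: neq; rewrite -nth_adjl // Ez nth_index // eqxx.
- move=> s1 n1 [Im [[Irm Irk Ire [Irr Irj Irx Irq]] Iry] Iz In] /=.
  rewrite Im Iry Irx -/x -/y => stop.
  have Ez : mem s Aadj (mem s Abase y + reg s1 Rz) = x by apply/eqP; move: stop; lia.
  have zlt : reg s1 Rz < mem s Anum y by lia.
  do 3 (try step); apply: HQ => //=; rewrite ?Im ?Iry -?/y //.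
  + move=> i j ltij ltj /=; rewrite ?Im ?Iry -/y.
    by have := dj i j ltij ltj; case: eqVneq => [->|_]; lia.
  + rewrite /adjl /= ?Im ?Iry -/y eqxx subn1 -Ez.
    have := perm_delete (fun k => mem s Aadj (mem s Abase y + k)) zlt.
    apply: perm_trans; rewrite perm_sym; apply: eq_perm; apply: eq_mkseq => k /=.
    by rewrite eqn_add2l.
  + move=> i im ni; apply: eq_adjl; rewrite /= ?Im ?Iry -?/y //; first by rewrite (negPf ni).
    move=> k ki; case: eqVneq => // Ek.
    by have := dj i y; have := dj y i; lia.
  + lia.
Qed.

Lemma nth_notin_take (s : seq nat) k : uniq s -> k < size s -> nth 0 s k \notin take k s.
Proof.
by move=> us ltk; have := take_uniq k.+1 us; rewrite (take_nth 0) // rcons_uniq => /andP[].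
Qed.

Section Update.
(** [s] is the store just after a removal, while [old] stands for membership in [E'] before it, when
    the stored lists were still exact. *)
Variables (s : store) (m D : nat) (old : pred nat).
Let e := reg s Re.
Let L := adjl s.

Hypothesis em : e < m.
Hypothesis dj : disjoint_blocks s m.
Hypothesis alive_old : forall i, alive s i -> old i.
Hypothesis old_e : old e.
Hypothesis adj_dead : forall i, i \in L e -> ~~ alive s i.
Hypothesis adj_old : forall i, i < m -> old i -> uniq (L i) /\ size (L i) <= D.
Hypothesis adj_sym : forall i j, i < m -> old i -> j \in L i ->
  [/\ j < m, old j & i \in L j].
Hypothesis dead_e : ~~ alive s e.

(** Each removed [x] is deleted from the lists of its alive neighbours, and by symmetry these are
    all the alive lists containing [x]. There are at most [D] of them, each searched in time linear
    in [D]. *)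
Lemma update_overlapping_runs n k0 (Q : store -> nat -> Prop) :
    size (L e) * (D * (40 * D + 120) + 60) + 40 + k0 <= n ->
    (forall s' k,
       [/\ mem s' Aalive = mem s Aalive & mem s' Aout = mem s Aout] ->
       [/\ reg s' Rm = reg s Rm, reg s' Rk = reg s Rk & reg s' Rr = reg s Rr] ->
       disjoint_blocks s' m ->
       (forall i, i < m -> alive s i ->
          perm_eq (adjl s' i) [seq z <- L i | z \notin L e]) ->
       k0 <= k -> Q s' k) ->
  runs update_overlapping s n Q.
Proof.
move=> le_n HQ; rewrite /update_overlapping; do 2 step.
(* The loops run over the lists of dead edges but modify only lists of alive ones, so the lists
   being traversed do not change. *)
pose core s1 :=
  [/\ mem s1 Aalive = mem s Aalive /\ mem s1 Aout = mem s Aout,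
      [/\ reg s1 Rm = reg s Rm, reg s1 Rk = reg s Rk & reg s1 Rr = reg s Rr],
      disjoint_blocks s1 m, reg s1 Re = e
    & forall i, i < m -> ~~ alive s i -> adjl s1 i = L i].
(* An opaque name for the product keeps the later arithmetic linear. *)
have [W EW] : exists W, W = D * (40 * D + 120) by exists (D * (40 * D + 120)).
rewrite -EW in le_n.
pose I s1 n1 :=
  [/\ core s1, reg s1 Rj <= size (L e),
      forall i, i < m -> alive s i ->
        perm_eq (adjl s1 i) [seq z <- L i | z \notin take (reg s1 Rj) (L e)]
    & (size (L e) - reg s1 Rj) * (W + 60) + 30 + k0 <= n1].
have [uniqLe _] := adj_old em old_e.
apply: (runs_while (I := I)).
- split=> //=; last by rewrite subn0; lia.
  by move=> i _ _; rewrite take0 filter_predT.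
- by move=> s1 n1 [_ _ _]; set X := _ * (W + 60) => /=; lia.
- move=> s1 n1 [core1 _ Ip In]; rewrite /=.
  have [[_ _] _ _ Ere Idead] := core1.
  rewrite Ere -(size_adjl s1) Idead // => ltj.
  move Ej: (reg s1 Rj) ltj Ip In => j ltj Ip In.
  move: In; rewrite -(subnSK ltj) mulSn; set R := _ * (W + 60) => In.
  have n1_ge : W + 90 <= n1 by clear -In; lia.
  set x := nth 0 (L e) j.
  have xLe : x \in L e by apply: mem_nth.
  have [xm old_x eLx] := adj_sym em old_e xLe.
  have [uniqLx sizeLx] := adj_old xm old_x.
  have dead_x := adj_dead xLe.
  have Ex : mem s1 Aadj (mem s1 Abase e + j) = x.
    by rewrite -nth_adjl ?Idead // -size_adjl Idead.
  do 5 (try step); rewrite /= Ere Ej Ex.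
  (* While [x] is processed, it has been deleted exactly from the alive lists among its first [Rq]
     neighbours. *)
  pose J s2 n2 :=
    [/\ core s2, reg s2 Rx = x /\ reg s2 Rj = j, reg s2 Rq <= size (L x),
        forall i, i < m -> alive s i ->
          perm_eq (adjl s2 i) [seq z <- L i | (z \notin take j (L e))
                        && ~~ ((z == x) && (i \in take (reg s2 Rq) (L x)))]
      & (size (L x) - reg s2 Rq) * (40 * D + 120) + 20 + R + 30 + k0 <= n2].
  apply: (runs_while (I := J)).
  + split=> //=.
      move=> i im ai; rewrite take0; under eq_filter do rewrite andbF andbT.
      exact: Ip.
    by rewrite subn0; have := leq_mul sizeLx (leqnn (40 * D + 120)); rewrite -EW; lia.
  + by move=> s2 n2 [_ _ _ _]; set X := _ * (40 * D + 120) => /=; lia.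
  + move=> s2 n2 [core2 [Jx Jj] _ Jp Jn]; rewrite /=.
    have [[Jal Jout] [Jrm Jrk Jrr] Jdj Jre Jdead] := core2.
    rewrite Jx -(size_adjl s2) Jdead // => ltq.
    move Eq: (reg s2 Rq) ltq Jp Jn => q ltq Jp Jn.
    move: Jn; rewrite -(subnSK ltq) mulSn; set R' := _ * (40 * D + 120) => Jn.
    have n2_ge : 40 * D + 140 <= n2 by clear -Jn; lia.
    set y := nth 0 (L x) q.
    have yLx : y \in L x by apply: mem_nth.
    have [ym old_y xLy] := adj_sym xm old_x yLx.
    have Ey : mem s2 Aadj (mem s2 Abase x + q) = y.
      by rewrite -nth_adjl ?Jdead // -size_adjl Jdead.
    have take_q i : i \in take q.+1 (L x) = (i == y) || (i \in take q (L x)).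
      by rewrite (take_nth 0) // mem_rcons inE.
    have y_q : y \notin take q (L x) by apply: nth_notin_take.
    have x_j : x \notin take j (L e) by apply: nth_notin_take.
    do 4 (try step); rewrite /= Jx Eq Ey Jal -/(alive s y) => ay; last first.
      step; step; split=> //=; rewrite ?Eq ?addn1 -/R' //; last by clear -Jn; lia.
      move=> i im ai; rewrite take_q; case: eqVneq => [Ei|_]; last exact: Jp.
      by rewrite -Ei ai in ay.
    have perm_y := Jp y ym ay.
    have size_y : mem s2 Anum y <= D.
      rewrite -size_adjl (perm_size perm_y) size_filter.
      by apply: leq_trans (count_size _ _) _; case: (adj_old ym old_y).
    apply: (delete_from_set_runs (m := m) (k0 := n2 - (40 * D + 80))) => //=.
    * rewrite (_ : adjl _ y = adjl s2 y) // (perm_mem perm_y) mem_filter.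
      by rewrite Jx x_j eqxx xLy /= y_q.
    * by clear -n2_ge size_y; lia.
    move=> s3 n3 [Kal Kout] [Krm Krk Kre [Krr Krj Krx Krq]] Kdj Kperm Krest n3_le.
    have n3_ge : 60 <= n3 by clear -n2_ge n3_le; lia.
    step; split=> /=; rewrite ?Krq ?Eq ?addn1 //; [| by rewrite Krx Krj | | by clear -Jn n3_le; lia].
      split=> //=; [by rewrite Kal Kout | by rewrite Krm Krk Krr | by rewrite Kre | ].
      move=> i im di; rewrite -(Jdead i im di); apply: (Krest i im).
      by apply: contraNneq di => ->.
    move=> i im ai; rewrite take_q; case: eqVneq => [Ei|ni] /=; last first.
      by rewrite (_ : adjl _ i = adjl s3 i) // Krest //; apply: Jp.
    rewrite Ei (_ : adjl _ y = adjl s3 y) //; apply: perm_trans Kperm _.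
    rewrite (_ : adjl _ y = adjl s2 y) //; rewrite Jx rem_filter; last first.
      by rewrite (perm_uniq perm_y) filter_uniq //; case: (adj_old ym old_y).
    apply: perm_trans (perm_filter _ perm_y) _.
    rewrite -filter_predI; apply: eq_perm; apply: eq_filter => z /=.
    by case: (z == x); rewrite /= ?andbF ?andbT.
  + move=> s2 n2 [core2 [Jx Jj] Jle Jp Jn]; rewrite /=.
    have [[Jal Jout] [Jrm Jrk Jrr] Jdj Jre Jdead] := core2.
    rewrite Jx -(size_adjl s2) Jdead // => stop.
    have Eq : reg s2 Rq = size (L x) by clear -Jle stop; lia.
    step; split=> //=; rewrite ?Jj ?addn1 -/R //; last by move: Jn; rewrite Eq subnn; clear; lia.
    move=> i im ai; rewrite (_ : adjl _ i = adjl s2 i) //.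
    apply: perm_trans (Jp i im ai) _; rewrite Eq take_size; apply: eq_perm.
    (* An alive [i] with [x] in its list lies in [L x] by symmetry, so the completed inner loop has
       treated it. *)
    apply: eq_in_filter => z zLi; rewrite (take_nth 0) // mem_rcons inE -/x negb_or andbC.
    case: eqVneq => [Ez|//]; have [_ _] := adj_sym im (alive_old ai) zLi.
    by rewrite Ez => ->.
- move=> s1 n1 [[[Ial Iout] Ir Idj Ire Idead] Ij Ip In]; rewrite /=.
  rewrite Ire -(size_adjl s1) Idead // => stop.
  have Ej : reg s1 Rj = size (L e) by clear -Ij stop; lia.
  apply: HQ => //; last by move: In; rewrite Ej subnn; clear; lia.
  by move=> i im ai; have := Ip i im ai; rewrite Ej take_size.
Qed.

End Update.

(** * Edges as numbers: the numbering is a bijection, and counts become cardinalities *)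

Section EdgeNumbering.
Variables (E : finType) (eid : E -> 'I_#|E|).
Hypothesis eid_inj : injective eid.

Lemma eid_nat_inj : injective (fun e => eid e : nat).
Proof. by move=> e f /ord_inj/eid_inj. Qed.

Lemma eid_onto i : i < #|E| -> exists e, eid e = i :> nat.
Proof.
move=> lti; have [|g _ gK] := inj_card_bij eid_inj; first by rewrite card_ord.
by exists (g (Ordinal lti)); rewrite gK.
Qed.

Lemma count_eid (P : pred nat) : count P (iota 0 #|E|) = #|[set e | P (eid e)]|.
Proof.
have /permP-> : perm_eq (iota 0 #|E|) [seq (eid e : nat) | e <- enum E].
  apply: uniq_perm; rewrite ?iota_uniq ?(map_inj_uniq eid_nat_inj) ?enum_uniq // => i.
  rewrite mem_iota; apply/idP/mapP => [/eid_onto[e <-]|[e _ ->]]; last exact: ltn_ord.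
  by exists e; rewrite ?mem_enum.
by rewrite count_map cardsE cardE enumT /enum_mem size_filter; apply: eq_count.
Qed.

End EdgeNumbering.

(** * One round of the main loop, and its iteration *)

Section GreedyLoop.
Variables (V E : finType) (T : nat) (G : temporal_graph V E T).
Variables (eid : E -> 'I_#|E|) (ov : rel nat) (D : nat).
Hypothesis eid_inj : injective eid.
Hypothesis ov_eid : forall e f, ov (eid e) (eid f) = overlap G e f.
Hypothesis ov_le : forall i, i < #|E| -> count (ov i) (iota 0 #|E|) <= D.
Let m := #|E|.

Lemma ov_sym i j : i < m -> j < m -> ov i j = ov j i.
Proof.
by move=> /(eid_onto eid_inj)[e <-] /(eid_onto eid_inj)[f <-]; rewrite !ov_eid overlap_sym.
Qed.

Lemma ov_irr i : i < m -> ov i i = false.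
Proof. by move=> /(eid_onto eid_inj)[e <-]; rewrite ov_eid overlap_irr. Qed.

Definition alive_edges (s : store) : {set E} := [set e | alive s (eid e)].

(** Only up to permutation, because deletions reorder the lists. *)
Definition adjacency_ok (s : store) : Prop :=
  forall i, i < m -> alive s i ->
    perm_eq (adjl s i) [seq j <- iota 0 m | alive s j && ov i j].

Lemma overlapping_number_eid s e : adjacency_ok s -> e \in alive_edges s ->
  overlapping_number G (alive_edges s) e = mem s Anum (eid e).
Proof.
move=> ok; rewrite inE => ae.
rewrite -size_adjl (perm_size (ok _ (ltn_ord _) ae)) size_filter (count_eid eid_inj).
by apply: eq_card => f; rewrite !inE ov_eid.
Qed.

Lemma mem_adjl s i j : adjacency_ok s -> i < m -> alive s i ->
  (j \in adjl s i) = [&& j < m, alive s j & ov i j].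
Proof.
move=> ok im ai; rewrite (perm_mem (ok _ im ai)) mem_filter mem_iota /= add0n.
by rewrite andbC.
Qed.

(** [W] pays for deleting one edge from at most [D] lists of at most [D] entries. [K] is the
    potential of one edge of [E']; it adds the cost of a selection, used when the edge is the chosen
    one. *)
Let W := D * (40 * D + 120).
Let K := 70 * m + W + 300.

(** The last clause looks ahead: every way of finishing from the current [E'] and [M] yields a
    greedy output. Since [greedy_from] puts its first step in front, this form can be advanced round
    by round. *)
Definition greedy_state (s : store) (l : seq E) : Prop :=
  [/\ [/\ reg s Rm = m, reg s Rr = count (alive s) (iota 0 m),
          disjoint_blocks s m & adjacency_ok s],
      uniq l, {in l, forall e, e \notin alive_edges s},
      [seq mem s Aout k | k <- iota 0 (reg s Rk)] = [seq (eid e : nat) | e <- l]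
    & forall M', greedy_from G (alive_edges s) [set e in l] M' -> greedy_output G M'].

Definition greedy_body : cmd :=
  (select_minimum;;
   Aout.[Rk] ::= Re;; Rk ::= Rk + 1;;
   remove_selected;;
   update_overlapping)%ram.

(* The slack of 20 units pays for the test of the enclosing loop. *)
Lemma greedy_body_runs s n k0 l (Q : store -> nat -> Prop) :
    greedy_state s l -> 0 < reg s Rr ->
    reg s Rr * K + k0 <= n + 20 ->
    (forall s' k l', greedy_state s' l' -> reg s' Rr * K + k0 <= k -> Q s' k) ->
  runs greedy_body s n Q.
Proof.
move=> [[Srm Srr Sdj Sok] Sl Sal Sout Sgr] Rr_gt0 le_n HQ; rewrite /greedy_body.
have [k1 Ek1] : exists k1, k1 = n - (70 * m + 50) by exists (n - (70 * m + 50)).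
have K_n : K <= n + 20.
  by apply: leq_trans le_n; apply: leq_trans (leq_addr _ _); apply: leq_pmull.
step; apply: (select_minimum_runs (k0 := k1)).
- by rewrite Srm Ek1; clear -K_n; rewrite /K in K_n; lia.
- rewrite Srm; move: Rr_gt0; rewrite Srr -has_count => /hasP[i].
  by rewrite mem_iota add0n => im ai; exists i.
rewrite Srm => s1 n1 E1 [E1m E1k E1r] e_lt e_alive e_min n1_le.
move Ee: (reg s1 Re) e_lt e_alive e_min => e em ae e_min.
have [e' Ee'] := eid_onto eid_inj em.
set L := adjl s e.
have memL j : (j \in L) = [&& j < m, alive s j & ov e j] by apply: mem_adjl.
have uniqL i : i < m -> alive s i -> uniq (adjl s i).
  by move=> im ai; rewrite (perm_uniq (Sok _ im ai)) filter_uniq ?iota_uniq.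
have sizeL i : i < m -> alive s i -> size (adjl s i) <= D.
  move=> im ai; rewrite (perm_size (Sok _ im ai)) size_filter.
  by apply: leq_trans (ov_le im); apply: sub_count => j /andP[].
have eL : e \notin L by rewrite memL ov_irr ?andbF.
pose dead' j := (j == e) || (j \in L).
(* The removed edges [e :: L] and the survivors partition [E']. This yields both the new value of
   [Rr] and the drop of the potential. *)
have count_alive : count (alive s) (iota 0 m)
    = (size L).+1 + count (fun j => alive s j && ~~ dead' j) (iota 0 m).
  rewrite -!size_filter -[(size L).+1]/(size (e :: L)) -size_cat.
  apply: perm_size; apply: uniq_perm; rewrite ?filter_uniq ?iota_uniq //.
    rewrite cat_uniq /= eL uniqL // filter_uniq ?iota_uniq //.
    rewrite andTb andbT.
    apply/hasPn => j; rewrite mem_filter inE => /andP[/andP[_]].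
    by rewrite /dead' negb_or /=.
  move=> j; rewrite mem_cat !mem_filter !mem_iota add0n /= inE -/(dead' j).
  case dj : (dead' j) => /=; rewrite ?andbT ?andbF //.
  move: dj; rewrite /dead' memL => /orP[/eqP->|/and3P[-> -> _]//].
  by rewrite ae em.
have n_ge : (size L).+1 * K
      + count (fun j => alive s j && ~~ dead' j) (iota 0 m) * K + k0 <= n + 20.
  by move: le_n; rewrite Srr count_alive mulnDl.
move: n_ge; set R := count _ _ * K => n_ge.
(* The chosen edge pays for the selection, every other removed edge for its deletion from the
   remaining lists. *)
have {}n_ge : 70 * m + 300 + size L * (W + 300) + R + k0 <= n + 20.
  apply: leq_trans n_ge; rewrite !leq_add2r mulSn /K.
  have := leq_mul (leqnn (size L)) (leq_addl (70 * m) (W + 300)).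
  by rewrite addnA; clear; lia.
rewrite mulnDr in n_ge.
have {}n1_le : 220 + (size L * W + size L * 300) + R + k0 <= n1.
  by clear -n_ge n1_le Ek1; lia.
do 5 (try step); rewrite /= E1k Ee.
apply: (remove_selected_runs (k0 := 150 + size L * W + size L * 60 + R + k0)).
  by rewrite /= Ee E1 -size_adjl -/L; clear -n1_le; lia.
rewrite /= Ee ?E1k ?E1m ?E1r ?E1.
move=> s3 n3 [E3b E3n E3a E3o] [E3m E3k E3e E3r] E3al n3_le.
have adj3 i : adjl s3 i = adjl s i by apply: eq_adjl; rewrite ?E3b ?E3n ?E3a /= ?E1.
have alive3 j : alive s3 j = alive s j && ~~ dead' j.
  rewrite /alive E3al (_ : adjl _ e = L); last by apply: eq_adjl; rewrite /= ?E1.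
  by rewrite -/(dead' j); case: (dead' j); rewrite ?andbT ?andbF.
apply: (@update_overlapping_runs s3 m D (alive s) _ _ _ _ _ _ _ _ n3 (R + k0 + 30)).
- by rewrite E3e.
- by move=> i j ij jm; rewrite E3b E3n; apply: Sdj.
- by move=> i; rewrite alive3 => /andP[].
- by rewrite E3e.
- by move=> i; rewrite E3e adj3 alive3 /dead' => ->; rewrite orbT andbF.
- by move=> i im ai; rewrite adj3; split; [apply: uniqL | apply: sizeL].
- move=> i j im ai; rewrite !adj3 mem_adjl // => /and3P[jm aj ij].
  by split=> //; rewrite mem_adjl // im ai ov_sym.
- by rewrite E3e alive3 /dead' eqxx andbF.
- by rewrite E3e adj3 -/L -/W; clear -n3_le; rewrite mulnDr; lia.
move=> s4 n4 [E4al E4o] [E4m E4k E4r] E4dj E4perm n4_le.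
have alive4 j : alive s4 j = alive s j && ~~ dead' j by rewrite -alive3 /alive E4al.
have e'_alive : e' \in alive_edges s by rewrite inE Ee'.
have edges4 : alive_edges s4
    = alive_edges s :\: (e' |: overlapping_edges G (alive_edges s) e').
  apply/setP => f; rewrite !inE alive4 /dead' memL ltn_ord -Ee' ov_eid /=.
  by rewrite (inj_eq (eid_nat_inj eid_inj)) andbC.
have Rr4 : reg s4 Rr = count (fun j => alive s j && ~~ dead' j) (iota 0 m).
  by rewrite E4r E3r Srr -size_adjl -/L count_alive addKn.
apply: (HQ s4 n4 (rcons l e')); last by rewrite Rr4 -/R; clear -n4_le; lia.
split.
- split=> //; first by rewrite E4m E3m.
    by rewrite Rr4; apply: eq_count => j; rewrite alive4.
  move=> i im ai4; have a3 : alive s3 i by rewrite alive3 -alive4.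
  have ai : alive s i by move: a3; rewrite alive3 => /andP[].
  apply: perm_trans (E4perm i im a3) _; rewrite E3e !adj3 -/L.
  apply: perm_trans (perm_filter _ (Sok i im ai)) _; apply: eq_perm.
  rewrite -filter_predI; apply: eq_in_filter => j; rewrite mem_iota add0n /= => jm.
  rewrite alive4 /dead' negb_or; case: eqVneq => [->|_] /=; last first.
    by rewrite andbCA andbA.
  (* The update deletes only members of [L], yet [e] cannot stay in the list of a survivor: an alive
     edge overlapping [e] belongs to [L] and was removed. *)
  rewrite andbF /=; apply/negP => /and3P[_ _ ie].
  move: a3; rewrite alive3 /dead' memL im ai ov_sym // ie /= orbT.
  by [].
- rewrite rcons_uniq Sl andbT; apply/negP => /Sal; by rewrite e'_alive.
- move=> f; rewrite mem_rcons inE edges4 !inE => /orP[/eqP->|]; first by rewrite eqxx.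
  by move=> /Sal; rewrite inE => /negPf->; rewrite andbF.
- rewrite E4k E3k E4o E3o addn1 iota0S !map_rcons -Sout Ee' /= eqxx; congr rcons.
  apply/eq_in_map => k; rewrite mem_iota add0n => ltk.
  by case: eqVneq => // Ek; rewrite Ek ltnn in ltk.
- move=> M' gr; apply: Sgr; apply: (greedy_step e'_alive).
    move=> f fa; rewrite !overlapping_number_eid // Ee'; apply: e_min => //.
    by rewrite inE in fa.
  rewrite -edges4 (_ : e' |: _ = [set f in rcons l e']) //.
  by apply/setP => f; rewrite !inE mem_rcons inE.
Qed.

(** The potential is [reg s Rr * K]. When [Rr] reaches 0 the set [E'] is empty, and [greedy_stop]
    closes the last clause of [greedy_state]. *)
Lemma greedy_loop_runs s n l (Q : store -> nat -> Prop) :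
    greedy_state s l -> reg s Rr * K + 10 <= n ->
    (forall s' k M, outputs eid s' M -> greedy_output G M -> Q s' k) ->
  runs (While (Lt 0 Rr) greedy_body) s n Q.
Proof.
move=> Sl le_n HQ.
pose I s1 n1 := exists2 l1, greedy_state s1 l1 & reg s1 Rr * K + 10 <= n1.
apply: (runs_while (I := I)); first by exists l.
- by move=> s1 n1 [l1 _]; set X := _ * K => /=; clear; lia.
- move=> s1 n1 [l1 S1 le1] /= Rr_gt0.
  apply: (greedy_body_runs (k0 := 10) S1) => //.
    by clear -le1; move: le1; set X := _ * K => le1; lia.
  by move=> s2 n2 l2 S2 le2; exists l2.
- move=> s1 n1 [l1 [[_ Srr _ _] Sl1 _ Sout Sgr] _] /=; rewrite -eqn0Ngt => /eqP Rr0.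
  apply: (HQ _ _ [set e in l1]); first by exists l1.
  apply: Sgr; rewrite (_ : alive_edges s1 = set0); first exact: greedy_stop.
  by apply/eqP; rewrite -cards_eq0 -(count_eid eid_inj) -Srr Rr0.
Qed.

End GreedyLoop.

(** * Reading the graph off the encoded input *)

Section Encoding.
Variables (V E : finType) (T : nat) (G : temporal_graph V E T).
Variables (vid : V -> nat) (eid : E -> 'I_#|E|) (s : store).
Hypothesis enc : encodes G vid eid s.

Lemma shares_eid e f : shares s (eid e) (eid f) = (ends G e :&: ends G f != set0).
Proof.
case: enc => vid_inj _ _ endsE _.
have [u [v [-> Eu Ev]]] := endsE e; have [u' [v' [-> Eu' Ev']]] := endsE f.
rewrite /shares Eu Ev Eu' Ev' !(inj_eq vid_inj).
apply/idP/set0Pn => [|[w]].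
  by case/orP=> [/orP[/orP[]|]|] /eqP->; [exists u' | exists v' | exists u' | exists v'];
    rewrite !inE eqxx ?orbT.
rewrite !inE => /andP[/orP[] /eqP-> /orP[] /eqP->]; rewrite eqxx ?orbT //.
Qed.

Lemma sorted_intervals_eid e :
  sorted_intervals (mem s Ais) (mem s Aif) (mem s Aib (eid e)) (mem s Ail (eid e)).
Proof.
case: enc => _ _ _ _ ivalsE; apply: sorted_intervals_map.
by rewrite -ivalsE; apply: ivals_sorted.
Qed.

Lemma size_intervals_eid e : mem s Ail (eid e) <= T.
Proof.
case: enc => _ _ _ _ ivalsE; have := size_intervals (ivals_sorted G e).
by move=> /(_ T (@ivals_lifetime _ _ _ G e)); rewrite ivalsE size_map size_iota.
Qed.

(** Two meeting intervals share the later of their starting points, a timestep below [T];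
    conversely, a common timestep lies at or after both starts and before both ends. *)
Lemma meets_eid e f :
  meets s (eid e) (eid f) = [exists t : 'I_T, exists_at G e t && exists_at G f t].
Proof.
case: (enc) => _ _ _ _ ivalsE.
have [lt_e _] := sorted_intervals_eid e; have [lt_f _] := sorted_intervals_eid f.
apply/hasP/existsP => [[k ke /hasP[l lf]] | [t]].
  rewrite /interval_meet /= => /andP[lt1 lt2].
  have ltT : maxn (mem s Ais k) (mem s Ais l) < T.
    have : mem s Aif k <= T.
      apply: (@ivals_lifetime _ _ _ G e (mem s Ais k, mem s Aif k)).
      by rewrite ivalsE; apply: (map_f (fun k => (mem s Ais k, mem s Aif k))).
    by have := lt_e k; rewrite -mem_iota ke => /(_ isT); lia.
  exists (Ordinal ltT); rewrite /exists_at !ivalsE !has_map.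
  have := lt_e k; rewrite -mem_iota ke => /(_ isT) ?.
  have := lt_f l; rewrite -mem_iota lf => /(_ isT) ?.
  by apply/andP; split; apply/hasP; [exists k | exists l] => //=; lia.
rewrite /exists_at !ivalsE !has_map => /andP[/hasP[k ke /= kt] /hasP[l lf /= lt]].
exists k => //; apply/hasP; exists l => //; rewrite /interval_meet /=; lia.
Qed.

Lemma store_overlap_eid e f : store_overlap s (eid e) (eid f) = overlap G e f.
Proof.
case: (enc) => _ eid_inj _ _ _.
by rewrite /store_overlap /overlap shares_eid meets_eid (inj_eq (eid_nat_inj eid_inj)) andbA.
Qed.

Lemma count_shares_le i : i < #|E| ->
  count (shares s i) (iota 0 #|E|) <= (max_degree G).*2.
Proof.
case: (enc) => _ eid_inj _ _ _ /(eid_onto eid_inj)[e <-].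
rewrite (count_eid eid_inj); apply: leq_trans (card_adjacent_edges G e).
by apply/eq_leq/eq_card => f; rewrite !inE shares_eid.
Qed.

End Encoding.

(** * Total cost and assembly *)

Lemma greedy_program_cost m d T :
  m * (60 * m + d.*2 * (80 * T + 200) + 60) + 60
   + (m * (70 * m + d.*2 * (40 * d.*2 + 120) + 300) + 30)
   <= 1000 * (m ^ 2 + m * d ^ 2 + m * d * T * trunc_log 2 T).+1.
Proof.
(* The monomials [m], [m * d] and [m * d * T] of the left side do not occur in the bound and are
   absorbed one by one. *)
have mm : m <= m * m by case: m => // k; apply: leq_pmulr.
have dd : m * d <= m * (d * d) by apply: leq_mul => //; case: d => // k; apply: leq_pmulr.
(* For T <= 1 the logarithm vanishes and the quadratic term takes over. *)
have dT : m * d * T <= m * (d * d) + m * d * T * trunc_log 2 T.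
  case: (leqP T 1) => [T1|T2].
    apply: leq_trans (leq_addr _ _); apply: leq_trans dd.
    by rewrite -{2}(muln1 (m * d)) leq_mul2l T1 orbT.
  apply: leq_trans (leq_addl _ _); apply: leq_pmulr.
  by rewrite trunc_log_gt0 T2.
(* The largest coefficient is that of [m * d ^ 2]: 160 directly, 640 from [m * d] and 160 from
   [m * d * T], so 960 in all. *)
rewrite -!mulnn -!muln2; lia.
Qed.

Theorem theorem6 :
  (forall (V E : finType) (T : nat) (G : temporal_graph V E T) (M : {set E}),
     greedy_output G M -> maximal_timed_matching G M) /\
  (exists C : nat,
     forall (V E : finType) (T : nat) (G : temporal_graph V E T)
       (vid : V -> nat) (eid : E -> 'I_#|E|) (s : store),
       encodes G vid eid s ->
       exists (t : nat) (s' : store) (M : {set E}),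
         [/\ exec greedy_program s t s',
             outputs eid s' M,
             greedy_output G M,
             maximal_timed_matching G M
           & t <= C * (time_bound G).+1]).
Proof.
split=> [V E T G M|]; first exact: greedy_output_maximal.
exists 1000 => V E T G vid eid s enc.
have [_ eid_inj Rm_s _ _] := enc.
pose D := (max_degree G).*2; pose ov := store_overlap s.
pose K := 70 * #|E| + D * (40 * D + 120) + 300.
have ov_le i : i < #|E| -> count (ov i) (iota 0 #|E|) <= D.
  move=> im; apply: leq_trans (count_shares_le enc im).
  by apply: sub_count => j /andP[/andP[]].
suff : runs greedy_program s (1000 * (time_bound G).+1)
         (fun s' _ => exists2 M, outputs eid s' M & greedy_output G M).
  move=> [t [s' [ex le_t [M out gr]]]]; exists t, s', M; split=> //.
  exact: greedy_output_maximal.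
apply: runs_seq.
(* The budget kept for the main loop: [K] for each edge, and 30 for the initial assignments and the
   last test. *)
apply: (@compute_overlapping_runs s T D _ _ _ _ (#|E| * K + 30)).
- by rewrite Rm_s => i /(eid_onto eid_inj)[e <-]; apply: (sorted_intervals_eid enc).
- by rewrite Rm_s => i /(eid_onto eid_inj)[e <-]; apply: (size_intervals_eid enc).
- by rewrite Rm_s => i; apply: (count_shares_le enc).
- by rewrite Rm_s; apply: greedy_program_cost.
move=> s1 k Rm1; rewrite /computed_upto Rm_s => -[alive1 adj1 base1] le_k.
have k_ge : 30 <= k by apply: leq_trans le_k; apply: leq_addl.
have al1 i : i < #|E| -> alive s1 i by move=> im; rewrite /alive alive1.
do 4 step.
apply: (@greedy_loop_runs _ _ _ G eid ov D eid_inj (store_overlap_eid enc) ov_le _ _ [::]).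
- split=> //=.
  + split=> //=; first by rewrite Rm1.
      rewrite Rm1 Rm_s -[LHS](size_iota 0); apply/esym/eqP; rewrite -all_count.
      by apply/allP => i; rewrite mem_iota; apply: al1.
    move=> i im _; rewrite (_ : adjl _ i = adjl s1 i) // adj1 //.
    apply: eq_perm; apply: eq_in_filter => j; rewrite mem_iota => jm.
    by rewrite (_ : alive _ j = alive s1 j) // al1.
  + move=> M; rewrite (_ : alive_edges _ _ = setT); last first.
      by apply/setP => e; rewrite !inE; apply: al1.
    by rewrite (_ : [set e in [::]] = set0) //; apply/setP => e; rewrite !inE.
- by rewrite /= Rm1 Rm_s -/K; clear -le_k; move: le_k; set X := _ * K; lia.
- by move=> s2 k2 M out gr; exists M.
Qed.
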